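(* Let $A \in \mathbb{Z}^{m\times n}$ with $\operatorname{rank}(A)=m\ge 1$, $b\in\mathbb{Z}^m$, $c\in\mathbb{Z}^n$, and assume the integer program (IP) $\max\{c^\top z : Az=b,\ z\in\mathbb{Z}^n_{\ge 0}\}$ is feasible and bounded. Then for every optimal vertex solution $x^*$ of the linear relaxation (LP) $\max\{c^\top x : Ax=b,\ x\in\mathbb{R}^n_{\ge 0}\}$, there exists an optimal solution $z^*$ of (IP) such that \[ \|z^*-x^*\|_1 < 3m^2 \log\bigl(2\sqrt{m}\cdot \Delta^{1/m}\bigr)\cdot \Delta . \]
   Context: For $k\in\{1,\dots,m\}$, $\Delta_k(A)$ denotes the largest absolute value of the determinant of a $k\times k$ submatrix of $A$, and $\Delta:=\Delta_m(A)$. All logarithms $\log$ are base 2. *)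

(* Defs.v *)
From Stdlib Require Import Reals.
From HB Require Import structures.
From mathcomp Require Import all_boot all_order all_algebra.
Set Implicit Arguments. Unset Strict Implicit. Unset Printing Implicit Defensive.
Import Order.TTheory GRing.Theory Num.Theory.

Definition int_to_R (z : int) : R :=
  match z with
  | Posz k => INR k
  | Negz k => Ropp (INR k.+1)
  end.

Definition Rsum (n : nat) (f : 'I_n -> R) : R := \big[Rplus/R0]_(j < n) f j.

(* Delta(A) = Delta_m(A): largest absolute value of the determinant of an
   m x m submatrix of A (columns selected by f; non-injective f give det 0). *)
Definition DeltaM (m n : nat) (A : 'M[int]_(m, n)) : nat :=
  \max_(f : {ffun 'I_m -> 'I_n}) absz (\det (colsub f A))%R.

Definition int_rank (m n : nat) (A : 'M[int]_(m, n)) : nat :=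
  \rank (map_mx (fun z : int => (z%:~R : rat)) A).

Definition ip_feasible m n (A : 'M[int]_(m, n)) (b : 'cV[int]_m) (z : 'cV[int]_n) : Prop :=
  (A *m z)%R = b /\ (forall j, (0 <= z j 0)%R).

Definition ip_obj n (c : 'cV[int]_n) (z : 'cV[int]_n) : int :=
  (\sum_(j < n) c j 0 * z j 0)%R.

Definition ip_bounded m n A b (c : 'cV[int]_n) : Prop :=
  exists M : int, forall z, @ip_feasible m n A b z -> (ip_obj c z <= M)%R.

Definition ip_optimal m n A b (c : 'cV[int]_n) (z : 'cV[int]_n) : Prop :=
  @ip_feasible m n A b z /\
  forall z', ip_feasible A b z' -> (ip_obj c z' <= ip_obj c z)%R.

Definition lp_feasible m n (A : 'M[int]_(m, n)) (b : 'cV[int]_m) (x : 'I_n -> R) : Prop :=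
  (forall i : 'I_m, Rsum (fun j => Rmult (int_to_R (A i j)) (x j)) = int_to_R (b i ord0))
  /\ (forall j, Rle R0 (x j)).

Definition lp_obj n (c : 'cV[int]_n) (x : 'I_n -> R) : R :=
  Rsum (fun j => Rmult (int_to_R (c j ord0)) (x j)).

Definition lp_vertex m n A b (x : 'I_n -> R) : Prop :=
  @lp_feasible m n A b x /\
  forall y w : 'I_n -> R, lp_feasible A b y -> lp_feasible A b w ->
    forall t : R, Rlt R0 t -> Rlt t R1 ->
    (forall j, x j = Rplus (Rmult t (y j)) (Rmult (Rminus R1 t) (w j))) ->
    forall j, y j = w j.

Definition lp_optimal_vertex m n A b (c : 'cV[int]_n) (x : 'I_n -> R) : Prop :=
  @lp_vertex m n A b x /\
  forall y, lp_feasible A b y -> Rle (lp_obj c y) (lp_obj c x).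

Definition l1_dist n (z : 'cV[int]_n) (x : 'I_n -> R) : R :=
  Rsum (fun j => Rabs (Rminus (int_to_R (z j ord0)) (x j))).

Definition log2 (t : R) : R := Rdiv (ln t) (ln 2).

Definition prox_bound (m : nat) (D : nat) : R :=
  Rmult (Rmult (Rmult 3 (Rmult (INR m) (INR m)))
          (log2 (Rmult (Rmult 2 (sqrt (INR m))) (Rpower (INR D) (Rinv (INR m))))))
        (INR D).

(* Main.v *)
(* Order the optimal solutions of (IP) by their distance to [x]. If [z] is
   optimal, [z - x] lies in the kernel of [A]; peel off multiples of integer
   circuits of [A] that agree in sign with [z - x], each with l1-norm at most
   (m + 1) Delta by Cramer's rule, and each killing a coordinate. As soon as a
   multiplier is at least 1, subtracting its circuit from [z] gives an optimal
   solution closer to [x]. Otherwise |z - x|_1 < k (m + 1) Delta, where k is the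
   dimension of the space of kernel vectors supported on supp x and supp z, and
   k <= |supp z| since the columns of [A] at the vertex [x] are independent.
   All this stays inside the union of supp x and the support of the initial [z],
   so it remains to start from a sparse optimal solution. If 2^s > Delta (s + 1)^m
   for s = |supp z|, two 0/1 vectors u, u' on supp z have the same image under
   [A]: for a basis B with |det B| = Delta there are Delta classes of A u modulo
   B Z^m, and the coordinates of B^-1 A u lie in intervals of length s. Then
   u - u' is a direction along which [z] can be moved until a coordinate
   vanishes. Hence 2^s <= Delta (s + 1)^m may be assumed, which implies
   (m + 1) s <= 3 m^2 log (2 sqrt m Delta^(1/m)). *)
Require Import Defs.
From Stdlib Require Import Reals Lra Lia Classical.
From HB Require Import structures.
From mathcomp Require Import all_boot all_order all_algebra.
Set Implicit Arguments. Unset Strict Implicit. Unset Printing Implicit Defensive.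

(** * The numerical estimate *)

Section Numeric.
Local Open Scope R_scope.

Lemma INR_expn a k : INR (a ^ k)%N = INR a ^ k.
Proof.
induction k as [|k IH]; [reflexivity|]. rewrite expnS -multE mult_INR IH. reflexivity.
Qed.

Lemma ln_le_sub1 x : 0 < x -> ln x <= x - 1.
Proof.
intros x0. pose proof (exp_ineq1_le (ln x)) as H. rewrite exp_ln in H; lra.
Qed.

Lemma ln_le x y : 0 < x -> x <= y -> ln x <= ln y.
Proof.
intros x0 [xy| ->]; [left; now apply ln_increasing|apply Rle_refl].
Qed.

(** Both bounds come from [ln x <= x - 1], at 19/20 and at 12/11, since (20/19)^13 <= 2 <=
    (12/11)^8. *)
Lemma ln2_bounds : 13/20 <= ln 2 <= 8/11.
Proof.
split.
- assert (H : ln ((20/19)^13) <= ln 2) by (apply ln_le; simpl; lra).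
  rewrite ln_pow in H; [|lra].
  assert (H1 : ln (20/19) = - ln (19/20)) by (rewrite <- ln_Rinv by lra; f_equal; field).
  pose proof (@ln_le_sub1 (19/20) ltac:(lra)). simpl INR in H. lra.
- assert (H : ln 2 <= ln ((12/11)^8)) by (apply ln_le; simpl; lra).
  rewrite ln_pow in H; [|lra].
  pose proof (@ln_le_sub1 (12/11) ltac:(lra)). simpl INR in H. lra.
Qed.

(** The ratio (s + 2)/(s + 1) decreases in s, so if the step from [s0] at most doubles the left
    side, every later step does too. *)
Lemma pow_le_pow2 (p k s0 : nat) :
  (INR s0 + 1) ^ p <= 2 ^ (s0 + k) -> (INR s0 + 2) ^ p <= 2 * (INR s0 + 1) ^ p ->
  forall t, (INR (s0 + t) + 1) ^ p <= 2 ^ (s0 + t + k).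
Proof.
intros base step t. induction t as [|t IH]; [now rewrite addn0|].
rewrite addnS S_INR. set (s := (s0 + t)%nat) in *.
assert (S0 : 0 <= INR s0) by apply pos_INR.
assert (S1 : INR s0 <= INR s) by (apply le_INR; unfold s; rewrite <- plusE; lia).
assert (P0 : 0 < (INR s0 + 1) ^ p) by (apply pow_lt; lra).
assert (P1 : 0 < (INR s + 1) ^ p) by (apply pow_lt; lra).
assert (H : ((INR s + 1 + 1) * (INR s0 + 1)) ^ p <= ((INR s0 + 2) * (INR s + 1)) ^ p).
{ apply pow_incr. nra. }
rewrite !Rpow_mult_distr in H.
assert (H2 : (INR s + 1 + 1) ^ p <= 2 * (INR s + 1) ^ p).
{ apply Rmult_le_reg_r with ((INR s0 + 1) ^ p); nra. }
rewrite addSn. simpl (2 ^ _). lra.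
Qed.

Lemma ln_succ_le (p k s : nat) : (INR s + 1) ^ p <= 2 ^ (s + k) ->
  INR p * ln (INR s + 1) <= (INR s + INR k) * ln 2.
Proof.
intros H. assert (S0 : 0 <= INR s) by apply pos_INR.
rewrite <- plus_INR, <- !ln_pow by lra.
apply ln_le; [apply pow_lt; lra|exact H].
Qed.

(** This bound and the next three settle m = 1, 2, 3, 4 in [ln_succ_bound]; the tangent argument
    there starts at m = 5. *)
Lemma cube_le_pow2 s : 3 * ln (INR s + 1) <= (INR s + 3) * ln 2.
Proof.
replace 3 with (INR 3) by (simpl; lra). apply ln_succ_le.
destruct s as [|[|[|s]]]; [simpl; lra..|].
apply (@pow_le_pow2 3 3 3); simpl; lra.
Qed.

Lemma fourth_le_pow2 s : 4 * ln (INR s + 1) <= (INR s + 6) * ln 2.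
Proof.
replace 4 with (INR 4) by (simpl; lra). replace 6 with (INR 6) by (simpl; lra).
apply ln_succ_le. destruct s as [|[|[|[|[|s]]]]]; [simpl; lra..|].
apply (@pow_le_pow2 4 6 5); simpl; lra.
Qed.

Lemma sixth_le_pow2 s : 11 < INR s -> 6 * ln (INR s + 1) <= (INR s + 11) * ln 2.
Proof.
intros s11. replace 6 with (INR 6) by (simpl; lra).
replace 11 with (INR 11) in * by (simpl; lra). apply INR_lt in s11.
apply ln_succ_le. replace s with (12 + (s - 12))%nat by (rewrite <- plusE, <- minusE; lia).
apply (@pow_le_pow2 6 11 12); simpl; lra.
Qed.

Lemma eighth_le_pow2 s : 19 < INR s -> 8 * ln (INR s + 1) <= (INR s + 16) * ln 2.
Proof.
intros s19. replace 8 with (INR 8) by (simpl; lra). replace 16 with (INR 16) by (simpl; lra).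
replace 19 with (INR 19) in * by (simpl; lra). apply INR_lt in s19.
apply ln_succ_le. replace s with (20 + (s - 20))%nat by (rewrite <- plusE, <- minusE; lia).
apply (@pow_le_pow2 8 16 20); simpl; lra.
Qed.

(** Taking logarithms in the counting bound and multiplying by 3 m leaves 3 m^2 ln (s + 1) on the
    right. This estimate trades it for 2 m - 1 of the 3 m copies of s ln 2 on the left, so that m +
    1 copies remain. *)
Lemma ln_succ_bound (m s : nat) : (0 < m)%N ->
  let M := INR m in let S := INR s in
  3 * (M * M) * ln 2 + 3 / 2 * (M * M) * ln M < (M + 1) * S * ln 2 ->
  3 * (M * M) * ln (S + 1)
    <= 3 * (M * M) * ln 2 + 3 / 2 * (M * M) * ln M + (2 * M - 1) * S * ln 2.
Proof.
intros m0 M S lt_s. pose proof ln2_bounds as l2.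
assert (S0 : 0 <= S) by apply pos_INR.
destruct m as [|[|[|[|[|m]]]]]; [discriminate| | | | |].
- assert (M1 : M = 1) by (unfold M; simpl; lra). rewrite M1 ln_1.
  pose proof (cube_le_pow2 s). unfold S in *. nra.
- assert (M2 : M = 2) by (unfold M; simpl; lra). rewrite M2.
  pose proof (fourth_le_pow2 s). unfold S in *. nra.
- assert (M3 : M = 3) by (unfold M; simpl; lra). rewrite M3 in lt_s |- *.
  assert (l3 : 3 / 2 * ln 2 <= ln 3).
  { assert (H : ln (2 ^ 3) <= ln (3 ^ 2)) by (apply ln_le; simpl; lra).
    rewrite !ln_pow in H; try lra. simpl INR in H. lra. }
  assert (s11 : 11 < S) by nra.
  pose proof (sixth_le_pow2 s11). unfold S in *. nra.
- assert (M4 : M = 4) by (unfold M; simpl; lra). rewrite M4 in lt_s |- *.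
  assert (l4 : ln 4 = 2 * ln 2).
  { replace 4 with (2 ^ 2) by (simpl; lra). rewrite ln_pow; simpl; lra. }
  rewrite l4 in lt_s |- *.
  assert (s19 : 19 < S) by nra.
  pose proof (eighth_le_pow2 s19). unfold S in *. nra.
- assert (M5 : 5 <= M).
  { unfold M. rewrite !S_INR. pose proof (pos_INR m). lra. }
  assert (l8 : ln 8 = 3 * ln 2).
  { replace 8 with (2 ^ 3) by (simpl; lra). rewrite ln_pow; simpl; lra. }
  (* The tangent to [ln] at [8 * M]. *)
  assert (tangent : M * ln (S + 1) <= M * ln M + 3 * M * ln 2 + (S + 1) / 8 - M).
  { set (q := (S + 1) / (8 * M)).
    assert (q0 : 0 < q) by (apply Rdiv_lt_0_compat; lra).
    assert (qE : S + 1 = M * 8 * q) by (unfold q; field; lra).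
    assert (H : ln (S + 1) = ln M + ln 8 + ln q).
    { rewrite qE. rewrite ln_mult; [|lra|exact q0]. rewrite ln_mult; lra. }
    assert (H1 := Rmult_le_compat_l M _ _ ltac:(lra) (ln_le_sub1 q0)).
    rewrite H l8. lra. }
  assert (tangent' := Rmult_le_compat_l (3 * M) _ _ ltac:(lra) tangent).
  (* As M - 2 = (2 M - 1) - (M + 1), there remains (M + 1) S ln 2 to absorb, by [lt_s], the other 3
     M^2 ln 2 + 3/2 M^2 ln M. *)
  assert (key : 3 * (M * M) * ln 2 + 3 * M * ((S + 1) / 8) - 3 * (M * M)
                <= (M - 2) * S * ln 2).
  { assert (K1 : 3 * (M * M) * ln 2 <= 3 * (M * M) * (3 / 4)).
    { apply Rmult_le_compat_l; nra. }
    assert (K2 : (M - 2) * S * (13/20) <= (M - 2) * S * ln 2).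
    { apply Rmult_le_compat_l; [apply Rmult_le_pos|]; lra. }
    assert (K3 : 0 <= (M - 5) * S) by (apply Rmult_le_pos; lra).
    nra. }
  nra.
Qed.

Lemma sparsity_bound (m D s : nat) : (0 < m)%N -> (0 < D)%N ->
  (2 ^ s <= D * s.+1 ^ m)%N ->
  (INR m + 1) * INR s
    <= 3 * (INR m * INR m) * log2 (2 * sqrt (INR m) * Rpower (INR D) (/ INR m)).
Proof.
intros m0 D0 le_pow. set (M := INR m). set (S := INR s).
assert (S0 : 0 <= S) by apply pos_INR.
assert (M1 : 1 <= M) by (apply (le_INR 1); apply/leP; exact m0).
assert (D1 : 1 <= INR D) by (apply (le_INR 1); apply/leP; exact D0).
pose proof ln2_bounds as l2.
assert (d0 : 0 <= ln (INR D)) by (rewrite <- ln_1; apply ln_le; lra).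
assert (logE : log2 (2 * sqrt M * Rpower (INR D) (/ M))
  = (ln 2 + ln M / 2 + ln (INR D) / M) / ln 2).
{ assert (sq0 : 0 < sqrt M) by (apply sqrt_lt_R0; lra).
  assert (lnsq : ln (sqrt M) = / 2 * ln M) by (rewrite <- Rpower_sqrt, ln_Rpower; lra).
  unfold log2. rewrite ln_mult; [|lra|apply exp_pos]. rewrite ln_mult; [|lra|exact sq0].
  rewrite lnsq ln_Rpower. field. lra. }
assert (le_ln : S * ln 2 <= ln (INR D) + M * ln (S + 1)).
{ unfold S, M. rewrite <- S_INR, <- !ln_pow, <- ln_mult; try lra.
  - apply ln_le; [apply pow_lt; lra|].
    replace 2 with (INR 2) by (simpl; lra). rewrite <- !INR_expn, <- mult_INR.
    apply le_INR. apply/leP. exact le_pow.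
  - apply pow_lt, lt_0_INR. lia.
  - apply lt_0_INR. lia. }
rewrite logE. apply Rmult_le_reg_r with (ln 2); [lra|].
replace (3 * (M * M) * ((ln 2 + ln M / 2 + ln (INR D) / M) / ln 2) * ln 2)
  with (3 * (M * M) * ln 2 + 3 / 2 * (M * M) * ln M + 3 * M * ln (INR D)) by (field; lra).
(* For small s the bound holds even without the nonnegative term in ln D; for large s, [le_ln] is
   multiplied by 3 M. *)
destruct (Rle_or_lt ((M + 1) * S * ln 2) (3 * (M * M) * ln 2 + 3 / 2 * (M * M) * ln M))
  as [small|large]; [nra|].
pose proof (ln_succ_bound m0 large) as H. fold M S in H. nra.
Qed.
End Numeric.

From mathcomp Require Import Rstruct zify ring lra.
Import Order.TTheory GRing.Theory Num.Theory.
Local Open Scope ring_scope.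

(** * Circuits *)

Lemma exists_basis m n (A : 'M[int]_(m, n)) :
  int_rank A = m -> exists f : {ffun 'I_m -> 'I_n}, \det (colsub f A) != 0.
Proof.
rewrite /int_rank; set Q := map_mx _ A => rkA.
have Qfull : row_full Q^T by rewrite /row_full mxrank_tr rkA.
exists [ffun i => fullrankfun Qfull i].
have : row_full (rowsub (fullrankfun Qfull) Q^T).
  by rewrite fullrowsub_full.
rewrite row_full_unit unitmxE -det_tr unitfE.
have -> : (rowsub (fullrankfun Qfull) Q^T)^T
  = map_mx intr (colsub [ffun i => fullrankfun Qfull i] A).
  by apply/matrixP => i j; rewrite !mxE ffunE.
by rewrite det_map_mx intr_eq0.
Qed.

Lemma det_le_DeltaM m n (A : 'M[int]_(m, n)) (f : {ffun 'I_m -> 'I_n}) :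
  `|\det (colsub f A)| <= (DeltaM A)%:Z.
Proof. by rewrite -abszE lez_nat /DeltaM leq_bigmax. Qed.

Lemma DeltaM_attained m n (A : 'M[int]_(m, n)) : int_rank A = m ->
  exists2 f : {ffun 'I_m -> 'I_n},
    \det (colsub f A) != 0 & `|\det (colsub f A)|%N = DeltaM A.
Proof.
move=> /exists_basis[f0 f0P].
have [f fP] : {f | DeltaM A = `|\det (colsub (f : {ffun 'I_m -> 'I_n}) A)|%N}.
  by apply: bigop.eq_bigmax; apply/card_gt0P; exists f0.
exists f => //.
by rewrite -absz_gt0 -fP; apply: leq_trans (leq_bigmax f0); rewrite absz_gt0.
Qed.

Section Circuit.
Variables (m n : nat) (A : 'M[int]_(m, n)).
Implicit Types f : {ffun 'I_m -> 'I_n}.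

Definition exchange f (i : 'I_m) (j : 'I_n) : {ffun 'I_m -> 'I_n} :=
  [ffun k => if k == i then j else f k].

(* det B (e_j - B^-1 A_j), where B is the basis matrix selected by [f]. *)
Definition circuit f (j : 'I_n) : 'cV[int]_n :=
  \col_k (\det (colsub f A) * (k == j)%:R
          - \sum_(i | f i == k) \det (colsub (exchange f i j) A)).

Lemma cramer f i j :
  (\adj (colsub f A) *m col j A) i 0 = \det (colsub (exchange f i j) A).
Proof.
rewrite mxE (expand_det_col _ i); apply: eq_bigr => k _.
rewrite !mxE mulrC ffunE eqxx; congr (_ * _).
rewrite /cofactor; congr (_ * \det _).
by apply/matrixP => a c; rewrite !mxE !ffunE eq_sym (negPf (neq_lift _ _)).
Qed.

Lemma sum_eq_ffun (V : nmodType) f l (F : 'I_n -> V) :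
  \sum_(k | f l == k) F k = F (f l).
Proof. by apply: big_pred1 => k; rewrite eq_sym. Qed.

(** By [cramer], this is the identity B adj(B) A_j = det(B) A_j. *)
Lemma circuit_ker f j : A *m circuit f j = 0.
Proof.
apply/matrixP => i k; rewrite {k}ord1 [RHS]mxE mxE.
under eq_bigr => k _ do rewrite mxE mulrBr.
rewrite sumrB (bigD1 j) //= eqxx mulr1 big1 ?addr0; last first.
  by move=> k /negPf ->; rewrite mulr0 mulr0.
apply/eqP; rewrite subr_eq0; apply/eqP.
under eq_bigr => k _ do rewrite big_distrr.
rewrite (exchange_big_dep xpredT) //=.
under eq_bigr => l _ do rewrite sum_eq_ffun -cramer.
have := congr1 (fun M : 'cV_m => M i 0) (mulmxA (colsub f A) (\adj (colsub f A)) (col j A)).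
rewrite mul_mx_adj mul_scalar_mx !mxE mulrC => <-.
by apply: eq_bigr => l _; rewrite mxE.
Qed.

(** The entries are built from m + 1 determinants of order m: det B at [j], and one exchanged
    determinant per basis column. *)
Lemma circuit_norm1 f j :
  \sum_k `|circuit f j k 0| <= (m.+1 * DeltaM A)%N%:Z.
Proof.
pose h k := `|\det (colsub f A)| * (k == j)%:R
          + \sum_(i | f i == k) `|\det (colsub (exchange f i j) A)|.
apply: (@le_trans _ _ (\sum_k h k)).
  apply: ler_sum => k _; rewrite mxE; apply: le_trans (ler_normB _ _) _.
  by rewrite lerD ?ler_norm_sum // normrM normr_nat.
rewrite big_split /= (bigD1 j) //= eqxx mulr1 big1 ?addr0; last first.
  by move=> k /negPf ->; rewrite mulr0.
rewrite (exchange_big_dep xpredT) //=.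
under [X in _ + X]eq_bigr => l _ do rewrite sum_eq_ffun.
rewrite mulSn PoszD lerD ?det_le_DeltaM //.
apply: le_trans (ler_sum _ (fun l _ => det_le_DeltaM A (exchange f l j))) _.
by rewrite sumr_const card_ord -mulr_natl natz PoszM.
Qed.

End Circuit.

(** * Circuits that agree in sign with a kernel vector *)

Section Conformal.
Variables (F : realFieldType) (m n : nat) (A : 'M[int]_(m, n)).
Implicit Types (f : {ffun 'I_m -> 'I_n}) (y w : 'cV[F]_n) (g : 'cV[int]_n).

Lemma basis_inj f : \det (colsub f A) != 0 -> injective f.
Proof.
move=> det_nz i1 i2 eqf; apply/eqP; apply: contraNT det_nz => i12.
rewrite -det_tr; apply/eqP; apply: (determinant_alternate i12) => k.
by rewrite !mxE eqf.
Qed.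

Lemma ker_supp_basis f y : \det (colsub f A) != 0 ->
  map_mx intr A *m y = 0 -> (forall j, y j 0 != 0 -> j \in codom f) -> y = 0.
Proof.
move=> det_nz Ay0 supp_y; have f_inj := basis_inj det_nz.
have Bunit : map_mx (intr : int -> F) (colsub f A) \in unitmx.
  by rewrite unitmxE unitfE det_map_mx intr_eq0.
have yf0 : \col_i y (f i) 0 = 0.
  apply: (can_inj (mulKmx Bunit)); rewrite mulmx0 -Ay0.
  apply/matrixP => i k; rewrite {k}ord1 !mxE [RHS](bigID (mem (f @: setT))) /=.
  rewrite [X in _ + X]big1 ?addr0; last first.
    move=> j; apply: contraNeq; rewrite mulf_eq0 negb_or => /andP[_ /supp_y].
    by case/codomP => k ->; apply: imset_f.
  rewrite big_imset /=; last by move=> *; apply: f_inj.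
  by apply: eq_big => [l|l _]; rewrite ?inE // !mxE.
apply/matrixP => j k; rewrite {k}ord1 mxE; apply/eqP/contraT => /[dup] ynz /supp_y.
case/codomP => i ji; have := congr1 (fun v : 'cV_m => v i 0) yf0.
by rewrite !mxE -ji => y0; rewrite y0 eqxx in ynz.
Qed.

(** The basis is chosen to meet the support of [y] in the most columns. By [ker_supp_basis] some [j]
    in the support lies outside it, and maximality keeps [circuit A f j] inside the support. *)
Lemma exists_circuit_in_support y : int_rank A = m ->
  map_mx intr A *m y = 0 -> y != 0 ->
  exists g, [/\ A *m g = 0, g != 0, forall k, y k 0 = 0 -> g k 0 = 0
              & \sum_k `|g k 0| <= (m.+1 * DeltaM A)%N%:Z].
Proof.
move=> rkA Ay0 ynz; have [f0 f0P] := exists_basis rkA.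
pose nb f := #|[set i | y (f i) 0 != 0]|.
have [f detf fmax] := @arg_maxnP _ f0 (fun f => \det (colsub f A) != 0) nb f0P.
have f_inj := basis_inj detf.
have [j /andP[yj jf]] : exists j, (y j 0 != 0) && (j \notin codom f).
  apply/existsP; apply: contraNT ynz; rewrite negb_exists => /forallP no_j.
  apply/eqP/(ker_supp_basis detf Ay0) => j yj.
  by have := no_j j; rewrite yj /= negbK.
exists (circuit A f j); split; [exact: circuit_ker| | |exact: circuit_norm1].
  apply: contra detf => /eqP/(congr1 (fun v : 'cV_n => v j 0)); rewrite !mxE eqxx mulr1.
  rewrite big1 ?subr0 => [->//|i /eqP fij].
  by rewrite -fij codom_f in jf.
move=> k yk0; rewrite mxE.
have /negPf-> : k != j by apply: contraNneq yj => <-; rewrite yk0.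
rewrite mulr0 big1 ?subrr // => i /eqP fik; apply/eqP/contraT => /fmax le_nb.
(* Exchanging [i] for [j] would put one more support element in the basis. *)
suff : (nb f < nb (exchange f i j))%N by move=> /leq_trans/(_ le_nb); rewrite ltnn.
have -> : nb (exchange f i j) = #|i |: [set l | y (f l) 0 != 0]|.
  by apply: eq_card => l; rewrite !inE ffunE; case: (eqVneq l i) => [->|//]; rewrite yj.
by rewrite cardsU1 inE fik yk0 eqxx.
Qed.

(** With t = y j / w j for the minimizing [j], t w is dominated by [y] entrywise and equals [y] at
    [j], so y - t w vanishes at [j] and flips no sign. *)
Lemma ratio_test y w : w != 0 -> (forall k, y k 0 = 0 -> w k 0 = 0) ->
  exists2 j, w j 0 != 0 & forall k, `|y j 0 / w j 0| * `|w k 0| <= `|y k 0|.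
Proof.
move=> wnz sub_wy.
have [j0 j0P] : exists j, w j 0 != 0.
  apply/existsP; apply: contraNT wnz; rewrite negb_exists => /forallP w0.
  by apply/eqP/matrixP => i k; rewrite {k}ord1 mxE; apply/eqP; rewrite -[_ == _]negbK.
case: (@Order.TotalTheory.arg_minP _ _ _ j0 (fun j => w j 0 != 0)
         (fun j => `|y j 0 / w j 0|) j0P) => j wj jmin.
exists j => // k; have [->|wk] := eqVneq (w k 0) 0; first by rewrite normr0 mulr0.
by rewrite -ler_pdivlMr ?normr_gt0 // -normf_div jmin.
Qed.

(** The product condition says nothing where [v] vanishes; the second clause keeps the support of
    [u] inside that of [v]. *)
Definition conformal (u v : 'cV[F]_n) :=
  forall k, 0 <= u k 0 * v k 0 /\ (v k 0 = 0 -> u k 0 = 0).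

Lemma conformal_trans u v w : conformal u v -> conformal v w -> conformal u w.
Proof.
move=> uv vw k; have [uv0 uvz] := uv k; have [vw0 vwz] := vw k.
split=> [|/vwz/uvz //]; have [/uvz->|vk] := eqVneq (v k 0) 0; first by rewrite mul0r.
have v2 : 0 < v k 0 * v k 0 by rewrite -expr2 exprn_even_gt0.
by rewrite -(pmulr_rge0 _ v2) mulrACA [v k 0 * u k 0]mulrC mulr_ge0.
Qed.

Lemma conformal_sub y w : (forall k, `|w k 0| <= `|y k 0|) -> conformal (y - w) y.
Proof.
move=> le_wy k; have := le_wy k; rewrite !mxE; split; last first.
  by move=> y0; move: H; rewrite y0 normr0 normr_le0 => /eqP->; rewrite subr0.
rewrite mulrBl subr_ge0 (le_trans (ler_norm _)) // normrM.
have <- : `|y k 0| * `|y k 0| = y k 0 * y k 0.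
  by rewrite -normrM ger0_norm // -expr2 sqr_ge0.
by rewrite ler_wpM2r.
Qed.

(** Induction on the size of the support: subtracting a multiple of a circuit kills a coordinate and
    leaves a vector conformal to [y], so a circuit conformal to that vector serves [y] too. If
    nothing is left, [y] is a multiple of the circuit and only the sign has to be chosen. *)
Lemma exists_conformal_circuit y : int_rank A = m ->
  map_mx intr A *m y = 0 -> y != 0 ->
  exists g, [/\ A *m g = 0, g != 0, conformal (map_mx intr g) y
              & \sum_k `|g k 0| <= (m.+1 * DeltaM A)%N%:Z].
Proof.
move=> rkA; have [N] := ubnP #|[set k | y k 0 != 0]|.
elim: N y => // N IH y; rewrite ltnS => leN Ay0 ynz.
have [g [Ag0 gnz supp_g norm_g]] := exists_circuit_in_support rkA Ay0 ynz.
pose w : 'cV[F]_n := map_mx intr g.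
have wnz : w != 0.
  apply: contra gnz => /eqP w0; apply/eqP/matrixP => k l.
  have := congr1 (fun v : 'cV_n => v k l) w0; rewrite !mxE => /eqP.
  by rewrite intr_eq0 => /eqP.
have [|j wj ratio] := @ratio_test y w wnz.
  by move=> k /supp_g; rewrite mxE => ->.
set t := y j 0 / w j 0 in ratio; pose y' := y - t *: w.
have yj : y j 0 != 0 by apply: contraNneq wj => /supp_g; rewrite mxE => ->.
have [y'0|y'nz] := eqVneq y' 0.
  have yE : y = t *: w by apply/eqP; rewrite -subr_eq0 -/y' y'0.
  have tnz : t != 0 by rewrite mulf_neq0 ?invr_eq0.
  exists (if 0 < t then g else - g); split.
  - by case: ifP => _ //; rewrite mulmxN Ag0 oppr0.
  - by case: ifP => _ //; rewrite oppr_eq0.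
  - move=> k; split; last by move=> /supp_g; case: ifP => _; rewrite !mxE => ->; rewrite ?oppr0.
    have -> : y k 0 = t * w k 0 by rewrite {1}yE mxE.
    have ww : 0 <= w k 0 * w k 0 by rewrite -expr2 sqr_ge0.
    case: ltP => t0.
      by rewrite -/w mulrCA mulr_ge0 ?(ltW t0).
    have -> : map_mx intr (- g) k 0 = - w k 0 by rewrite !mxE rmorphN.
    by rewrite mulNr mulrCA -mulNr mulr_ge0 ?oppr_ge0.
  - by case: ifP => _ //; under eq_bigr => k _ do rewrite mxE normrN.
have y'y : conformal y' y.
  by apply: conformal_sub => k; rewrite mxE normrM.
have Ay'0 : map_mx intr A *m y' = 0.
  by rewrite mulmxBr Ay0 -scalemxAr -map_mxM Ag0 map_mx0 scaler0 subrr.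
have [|h [Ah0 hnz hy' norm_h]] := IH y' _ Ay'0 y'nz.
  apply: leq_trans leN; apply/proper_card/properP; split.
    by apply/fintype.subsetP => k; rewrite !inE; apply: contra_neq => /(proj2 (y'y k)).
  by exists j; rewrite !inE // negbK /y' mxE [X in _ + X]mxE [X in _ - X]mxE divfK // subrr.
by exists h; split=> //; apply: conformal_trans y'y.
Qed.

End Conformal.

(** * Proximity *)

Section Descent.
Variables (F : realFieldType) (m n : nat) (A : 'M[int]_(m, n)).
Implicit Types (y w x : 'cV[F]_n) (g z : 'cV[int]_n) (S T : {set 'I_n}).

(* Kernel vectors of [A] supported on [S], as a row space. *)
Definition ker_on S : 'M[F]_n :=
  kermx (row_mx (map_mx intr A)^T (diag_mx (\row_j (j \notin S)%:R))).

Definition supp y : {set 'I_n} := [set j | y j 0 != 0].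

Lemma ker_onP S y :
  reflect (map_mx intr A *m y = 0 /\ forall j, j \notin S -> y j 0 = 0)
          (y^T <= ker_on S)%MS.
Proof.
rewrite sub_kermx mul_mx_row row_mx_eq0 -trmx_mul trmx_eq0.
apply: (iffP andP) => [[/eqP-> /eqP yS]|[-> yS]]; split=> //.
  move=> j jS; have := congr1 (fun v : 'rV_n => v 0 j) yS.
  by rewrite mul_mx_diag !mxE jS mulr1.
apply/eqP/matrixP => i j; rewrite mul_mx_diag !mxE {i}ord1.
by have [_|/yS->] := boolP (j \in S); rewrite ?mulr0 ?mul0r.
Qed.

Lemma ker_onS S T : S \subset T -> (ker_on S <= ker_on T)%MS.
Proof.
move=> sST; apply/row_subP => i; rewrite -[row i _]trmxK.
have /ker_onP[Av Sv] : ((row i (ker_on S))^T^T <= ker_on S)%MS by rewrite trmxK row_sub.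
by apply/ker_onP; split=> // j jT; apply: Sv; apply: contra jT; apply: (fintype.subsetP sST).
Qed.

Lemma rank_ker_on_lt S T y j : S \subset T -> j \notin S ->
  (y^T <= ker_on T)%MS -> y j 0 != 0 -> (\rank (ker_on S) < \rank (ker_on T))%N.
Proof.
move=> sST jS yT yj; apply: rank_ltmx; rewrite ltmxE ker_onS //=.
apply: contra yj => /(submx_trans yT)/ker_onP[_ yS].
by rewrite yS.
Qed.

(* A kernel vector supported on [S :|: T] is determined by its entries in [T]. *)
Lemma rank_ker_on_setU S T : ker_on S = 0 -> (\rank (ker_on (S :|: T)) <= #|T|)%N.
Proof.
move=> kS0; pose P : 'M[F]_(n, #|T|) := \matrix_(i, k) (i == enum_val k)%:R.
(* [P] projects to the coordinates in [T]; the kernel vectors that it kills are supported on [S],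
   hence zero. *)
rewrite -(mxrank_mul_ker _ P) [X in (_ + X)%N](_ : _ = 0)%N ?addn0 ?rank_leq_col //.
apply/eqP; rewrite mxrank_eq0 -submx0 -kS0; apply/row_subP => i.
have := row_sub i (ker_on (S :|: T) :&: kermx P)%MS; move: (row _ _) => v.
rewrite sub_capmx -[v]trmxK => /andP[/ker_onP[Av vST]]; rewrite trmxK sub_kermx => /eqP vP0.
rewrite -[v]trmxK; apply/ker_onP; split=> // j jS; have [jT|jT] := boolP (j \in T); last first.
  by apply: vST; rewrite inE negb_or jS.
have := congr1 (fun u : 'rV_#|T| => u 0 (enum_rank_in jT j)) vP0; rewrite !mxE.
rewrite (bigD1 j) //= mxE enum_rankK_in // eqxx mulr1 big1 ?addr0 // => k kj.
by rewrite mxE enum_rankK_in // (negPf kj) mulr0.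
Qed.

Lemma conformal_between (u v : F) : 0 <= u * v -> `|u| <= `|v| ->
  0 <= u <= v \/ v <= u <= 0.
Proof.
case: (ltrgt0P v) => [v0|v0|->]; last by rewrite normr_le0 => _ /eqP->; left; rewrite lexx.
  by rewrite pmulr_lge0 // => u0; rewrite ger0_norm // => ->; left; rewrite u0.
by rewrite nmulr_lge0 // => u0; rewrite ler0_norm // lerN2 => ->; right; rewrite u0.
Qed.

Lemma norm_sub_conformal (u v : F) : 0 <= u * v -> `|u| <= `|v| ->
  `|v - u| = `|v| - `|u|.
Proof.
move=> uv /(conformal_between uv)[]/andP[h1 h2].
  by rewrite !ger0_norm ?subr_ge0 //; lra.
by rewrite !ler0_norm ?subr_le0 //; lra.
Qed.

(** Each circuit peeled off kills a coordinate and so lowers the dimension, which [k] bounds. A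
    multiplier t < 1 costs less than [C] in norm, while t >= 1 means that the whole circuit fits
    below [y]. A circuit that fits below the remainder [y'] also fits below [y]. *)
Lemma conformal_descent k y : int_rank A = m ->
  map_mx intr A *m y = 0 ->
  (\rank (ker_on (supp y)) <= k)%N ->
  [\/ y = 0, \sum_j `|y j 0| < k%:R * (m.+1 * DeltaM A)%:R
   | exists g, [/\ A *m g = 0, g != 0, conformal (map_mx intr g) y
                 & forall j, `|(g j 0)%:~R| <= `|y j 0|]].
Proof.
move=> rkA; set C : F := (m.+1 * _)%:R; elim: k y => [|k IH] y Ay0.
  rewrite leqn0 mxrank_eq0 => /eqP k0; apply: Or31.
  have : (y^T <= ker_on (supp y))%MS.
    by apply/ker_onP; split=> // j; rewrite inE negbK => /eqP.
  by rewrite k0 submx0 trmx_eq0 => /eqP.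
move=> rk; have [->|ynz] := eqVneq y 0; first exact: Or31.
have [g [Ag0 gnz gy norm_g]] := exists_conformal_circuit rkA Ay0 ynz.
pose w : 'cV[F]_n := map_mx intr g.
have wE i : (g i 0)%:~R = w i 0 by rewrite mxE.
have norm_w : \sum_i `|w i 0| <= C.
  rewrite (eq_bigr (fun i => (`|g i 0|)%:~R)); last by move=> i _; rewrite mxE intr_norm.
  by rewrite -rmorph_sum /= -[C]/((m.+1 * DeltaM A)%N%:Z%:~R) ler_int.
have wnz : w != 0.
  apply: contra gnz => /eqP w0; apply/eqP/matrixP => i l.
  by apply/eqP; rewrite mxE -(intr_eq0 F) {l}ord1 wE w0 mxE.
have [|j wj ratio] := @ratio_test _ _ y w wnz; first by move=> i /(proj2 (gy i)).
have yj : y j 0 != 0 by apply: contraNneq wj => /(proj2 (gy j)) ->.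
have t0 : 0 < y j 0 / w j 0.
  rewrite lt_neqAle eq_sym mulf_neq0 ?invr_eq0 //=.
  have -> : y j 0 / w j 0 = w j 0 * y j 0 / w j 0 ^+ 2 by field.
  by rewrite divr_ge0 ?sqr_ge0 //; case: (gy j).
set t := y j 0 / w j 0 in ratio t0.
rewrite (gtr0_norm t0) in ratio.
have [t1|t1] := lerP 1 t.
  apply: Or33; exists g; split=> // i; apply: le_trans (ratio i).
  by rewrite wE ler_peMl.
pose y' := y - t *: w.
have le_tw i : `|(t *: w) i 0| <= `|y i 0| by rewrite mxE normrM (gtr0_norm t0).
have y'y : conformal y' y by apply: conformal_sub.
have y'E i : y' i 0 = y i 0 - t * w i 0 by rewrite /y' mxE [X in _ + X]mxE [X in _ - X]mxE.
have le_y' i : `|y' i 0| <= `|y i 0|.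
  rewrite y'E norm_sub_conformal ?lerBlDr ?lerDl //; last by have := le_tw i; rewrite mxE.
  by rewrite -mulrA mulr_ge0 ?(ltW t0) //; case: (gy i).
have Ay'0 : map_mx intr A *m y' = 0.
  by rewrite mulmxBr Ay0 -scalemxAr -map_mxM Ag0 map_mx0 scaler0 subrr.
have C0 : 0 < C.
  apply: lt_le_trans norm_w; rewrite (bigD1 j) //= ltr_pwDl ?normr_gt0 //.
  by rewrite sumr_ge0.
have sum_y : \sum_i `|y i 0| <= \sum_i `|y' i 0| + t * C.
  apply: (@le_trans _ _ (\sum_i (`|y' i 0| + t * `|w i 0|))).
    apply: ler_sum => i _; rewrite -[X in _ + X * _](gtr0_norm t0) -normrM.
    by rewrite -[X in `|X| <= _](subrK (t * w i 0)) y'E ler_normD.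
  by rewrite big_split /= -mulr_sumr lerD2l ler_wpM2l ?(ltW t0).
have tC : t * C < C by rewrite gtr_pMl.
have kS : k.+1%:R * C = k%:R * C + C by rewrite -addn1 natrD mulrDl mul1r.
have [|y'0|lt_y'|[h [Ah0 hnz hy' le_h]]] := IH y' Ay'0.
- rewrite -ltnS; apply: leq_trans rk; apply: (@rank_ker_on_lt _ _ y j) => //.
  + by apply/fintype.subsetP => i; rewrite !inE; apply: contra_neq => /(proj2 (y'y i)).
  + by rewrite inE negbK y'E divfK // subrr.
  + by apply/ker_onP; split=> // i; rewrite inE negbK => /eqP.
- apply: Or32; rewrite kS; apply: le_lt_trans sum_y _.
  rewrite y'0 big1 => [|i _]; last by rewrite mxE normr0.
  by rewrite add0r ltr_wpDl // mulr_ge0 ?(ltW C0).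
- by apply: Or32; rewrite kS; apply: le_lt_trans sum_y _; rewrite ltrD.
- apply: Or33; exists h; split=> //; first exact: conformal_trans y'y.
  by move=> i; apply: le_trans (le_h i) (le_y' i).
Qed.

End Descent.

Section Proximity.
Variables (F : realFieldType) (m n : nat) (A : 'M[int]_(m, n)).
Variables (b : 'cV[int]_m) (c : 'cV[int]_n) (x : 'cV[F]_n).
Implicit Types (g z : 'cV[int]_n) (S : {set 'I_n}).
Hypothesis rkA : int_rank A = m.
Hypothesis Ax : map_mx intr A *m x = map_mx intr b.
Hypothesis x_ge0 : forall j, 0 <= x j 0.
Hypothesis x_opt : forall u : 'cV[F]_n, map_mx intr A *m u = map_mx intr b ->
  (forall j, 0 <= u j 0) ->
  \sum_j (c j 0)%:~R * u j 0 <= \sum_j (c j 0)%:~R * x j 0.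

Let dist z := \sum_j `|(z j 0)%:~R - x j 0|.

(** A sign-compatible [g] dominated by z - x keeps z - g and x + g between x and z in every
    coordinate, hence nonnegative. Optimality of [x] against x + g gives c g <= 0, so z - g is again
    optimal. The distance drops by the l1-norm of [g], a positive integer. *)
Lemma closer_ip_optimal S k z :
  ip_optimal A b c z -> (forall j, j \notin S -> x j 0 = 0 /\ z j 0 = 0) ->
  (\rank (ker_on F A S) <= k)%N ->
  [\/ forall j, (z j 0)%:~R = x j 0,
      dist z < k%:R * (m.+1 * DeltaM A)%:R
    | exists z', [/\ ip_optimal A b c z', dist z' + 1 <= dist z
                   & forall j, j \notin S -> z' j 0 = 0]].
Proof.
move=> [[Az z_ge0] z_max] zS rkS; pose y := map_mx intr z - x.
have yE j : y j 0 = (z j 0)%:~R - x j 0 by rewrite !mxE.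
have Ay0 : map_mx intr A *m y = 0 by rewrite mulmxBr -map_mxM Az Ax subrr.
have rk_y : (\rank (ker_on F A (supp y)) <= k)%N.
  apply: leq_trans rkS; apply: mxrankS; apply: ker_onS.
  apply/fintype.subsetP => j; rewrite inE; apply: contraR => /zS[xj zj].
  by rewrite yE xj zj subrr.
case: (conformal_descent rkA Ay0 rk_y) => [y0|lt_y|[g [Ag0 gnz gy le_gy]]].
- by apply: Or31 => j; apply/eqP; rewrite -subr_eq0 -yE y0 mxE.
- by apply: Or32; rewrite (eq_bigr _ (fun j _ => congr1 _ (yE j))) in lt_y.
apply: Or33; exists (z - g).
have gy0 j : 0 <= (g j 0)%:~R * y j 0 by have [] := gy j; rewrite mxE.
have between j := conformal_between (gy0 j) (le_gy j).
have zg_feas : ip_feasible A b (z - g).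
  split=> [|j]; first by rewrite mulmxBr Az Ag0 subr0.
  rewrite !mxE -(ler0z F) rmorphB /=.
  have := x_ge0 j; have := z_ge0 j; rewrite -(ler0z F).
  by have := between j; rewrite yE; case=> /andP[h1 h2] h3 h4; lra.
have cg_le0 : \sum_j (c j 0)%:~R * (g j 0)%:~R <= 0 :> F.
  have := x_opt (u := x + map_mx intr g); rewrite mulmxDr Ax -map_mxM Ag0 map_mx0 addr0.
  rewrite (eq_bigr (fun j => (c j 0)%:~R * x j 0 + (c j 0)%:~R * (g j 0)%:~R)).
    rewrite big_split /= gerDl; apply=> // j; rewrite !mxE.
    have := x_ge0 j; have := z_ge0 j; rewrite -(ler0z F).
    by have := between j; rewrite yE; case=> /andP[h1 h2] h3 h4; lra.
  by move=> j _; rewrite !mxE mulrDr.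
split.
- split=> // z' /z_max le_z'; apply: le_trans le_z' _.
  rewrite /ip_obj [leRHS](eq_bigr (fun j => c j 0 * z j 0 - c j 0 * g j 0)); last first.
    by move=> j _; rewrite !mxE mulrBr.
  rewrite big_split /= sumrN lerDl oppr_ge0 -(lerz0 F) rmorph_sum /=.
  by under eq_bigr => j _ do rewrite rmorphM.
- have [j gj] : exists j, g j 0 != 0.
    apply/existsP; apply: contraNT gnz; rewrite negb_exists => /forallP g0.
    by apply/eqP/matrixP => j l; rewrite {l}ord1 mxE; apply/eqP; rewrite -[_ == _]negbK.
  have -> : dist (z - g) = dist z - \sum_i `|(g i 0)%:~R|.
    rewrite -sumrB; apply: eq_bigr => i _; rewrite -yE -norm_sub_conformal // yE !mxE.
    by rewrite rmorphB /= addrAC.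
  rewrite -addrA gerDl addrC subr_le0 (bigD1 j) //= -[leLHS]addr0 lerD ?sumr_ge0 //.
  by rewrite -intr_norm (ler_int F 1) -gtz0_ge1 normr_gt0.
- move=> j /zS[xj zj]; have := le_gy j; rewrite yE xj zj subrr normr0 normr_le0 intr_eq0.
  by rewrite !mxE zj => /eqP ->; rewrite subrr.
Qed.

(** [N] limits the number of moves, as each lowers the distance by at least 1. The moves stay
    supported on [S], so the rank bound persists. *)
Lemma ip_optimal_proximity S k z (N : nat) :
  ip_optimal A b c z -> (forall j, j \notin S -> x j 0 = 0 /\ z j 0 = 0) ->
  (\rank (ker_on F A S) <= k)%N -> dist z <= N%:R ->
  exists2 z', ip_optimal A b c z' &
    (forall j, (z' j 0)%:~R = x j 0) \/ dist z' < k%:R * (m.+1 * DeltaM A)%:R.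
Proof.
move=> z_opt zS rkS; elim: N z z_opt zS => [|N IH] z z_opt zS leN.
all: have [zx|lt_zx|[z' [z'_opt z'_lt z'S]]] := closer_ip_optimal z_opt zS rkS.
all: try by exists z; [|left].
all: try by exists z; [|right].
- suff : 0 <= dist z' by move: (le_trans z'_lt leN); lra.
  by apply: sumr_ge0.
- apply: (IH z') => // [j jS|]; first by split; [case: (zS j jS)|apply: z'S].
  by move: (le_trans z'_lt leN); rewrite -addn1 natrD; lra.
Qed.

End Proximity.

(** * Sparse optimal solutions *)

Section Sparsity.
Variables (m n : nat) (A : 'M[int]_(m, n)).

(* The residues of the entries of [M *m e] modulo the Smith invariants [d]
   separate the |det B| classes of Z^m modulo B Z^m. *)
Lemma lattice_classes (B : 'M[int]_m) : \det B != 0 ->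
  exists (d : 'I_m -> nat) (M : 'M[int]_m),
    [/\ (\prod_i d i = `|\det B|)%N, forall i, (0 < d i)%N
      & forall e : 'cV[int]_m, (forall i, (d i %| ((M *m e) i 0)%R)%Z) ->
        exists w, e = B *m w].
Proof.
move=> detB; have [L Lu [Q Qu [d _ defB]]] := int_Smith_normal_form B.
have unit1 (N : 'M[int]_m) : N \in unitmx -> `|\det N|%N = 1%N.
  by rewrite unitmxE => /orP[]/eqP->.
pose dg := \row_(i < m) d`_i.
have dgE : \matrix_(i < m, j < m) (d`_i *+ (i == j :> nat)) = diag_mx dg.
  by apply/matrixP => i j; rewrite !mxE.
rewrite dgE in defB.
have prod_d : (\prod_(i < m) `|(d`_i)%R| = `|\det B|)%N.
  rewrite defB !det_mulmx det_diag !abszM !unit1 // muln1 mul1n.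
  rewrite (big_morph absz abszM (erefl _)) //.
  by apply: eq_bigr => i _; rewrite mxE.
exists (fun i : 'I_m => `|(d`_i)%R|%N), (invmx L); split=> // [i|e de].
  rewrite lt0n; apply: contra detB => /eqP di0.
  by rewrite -absz_eq0 -prod_d (bigD1 i) //= di0 mul0n.
(* With B = L diag(d) Q, this solves diag(d) (Q w) = L^-1 e row by row; the divisions are exact by
   [de]. *)
exists (invmx Q *m \col_i (((invmx L *m e) i 0)%R %/ (d`_i)%R)%Z).
rewrite defB -!mulmxA mulKVmx //.
suff -> : diag_mx dg *m \col_i (((invmx L *m e) i 0)%R %/ (d`_i)%R)%Z = invmx L *m e.
  by rewrite mulKVmx.
apply/matrixP => i j; rewrite {j}ord1 mul_diag_mx [LHS]mxE [dg _ _]mxE [X in _ * X]mxE.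
by rewrite mulrC divzK //; have := de i; rewrite !dvdzE.
Qed.

Lemma divn_eq_dist (a b : int) (D : nat) : (0 < D)%N -> 0 <= a -> 0 <= b ->
  (`|a| %/ D)%N = (`|b| %/ D)%N -> `|a - b| < D%:Z.
Proof.
case: a => // a; case: b => // b; rewrite !absz_nat => D0 _ _ eq_div.
have := divn_eq a D; have := divn_eq b D; rewrite eq_div.
have := ltn_pmod a D0; have := ltn_pmod b D0.
by move: (a %% D)%N (b %% D)%N (b %/ D * D)%N => r1 r2 q; lia.
Qed.

Lemma exists_small_kernel_vector (S : {set 'I_n}) : int_rank A = m ->
  (DeltaM A * #|S|.+1 ^ m < 2 ^ #|S|)%N ->
  exists y : 'cV[int]_n, [/\ A *m y = 0, y != 0, forall j, `|y j 0| <= 1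
    & forall j, j \notin S -> y j 0 = 0].
Proof.
move=> rkA; set D := DeltaM A; set s := #|S| => lt_card.
have [f detB absB] := DeltaM_attained rkA; set B := colsub f A in detB absB.
have D0 : (0 < D)%N by rewrite /D -absB absz_gt0.
have [d [M [prod_d d0 dP]]] := lattice_classes detB.
pose a := \adj B *m A.
have a_le i j : `|a i j| <= D%:Z.
  have -> : a i j = (\adj B *m col j A) i 0.
    by rewrite !mxE; apply: eq_bigr => k _; rewrite [col _ _ _ _]mxE.
  by rewrite cramer det_le_DeltaM.
pose ind (U : {set 'I_n}) : 'cV[int]_n := \col_j (j \in U)%:R.
(* The shift max(- a i j, 0) puts each summand in [0, D] and cancels in [p U i - p U' i]. *)
pose t i j (U : {set 'I_n}) := a i j * (j \in U)%:R + Num.max (- a i j) 0.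
pose p U i : int := \sum_(j in S) t i j U.
have t_bnd i j U : 0 <= t i j U <= D%:Z.
  have := a_le i j; rewrite ler_norml /t => /andP[h1 h2].
  by case: (j \in U); rewrite ?mulr1 ?mulr0; case: (lerP (- a i j) 0) => h; lia.
have p_ge0 U i : 0 <= p U i by apply: sumr_ge0 => j _; case/andP: (t_bnd i j U).
(* Both ends of [0, s D] can occur, so there are s + 1 quotients by D. *)
have p_le U i : (`|p U i| %/ D < s.+1)%N.
  have : p U i <= (s * D)%N%:Z.
    apply: le_trans (ler_sum _ (fun j _ => proj2 (andP (t_bnd i j U)))) _.
    by rewrite sumr_const -mulr_natl natz PoszM.
  by rewrite ltn_divLR // mulSn; have := p_ge0 U i; lia.
pose v U i := (M *m (A *m ind U)) i 0.
pose r U i := `|(v U i %% d i)%Z|%N.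
have r_lt U i : (r U i < (d i).-1.+1)%N.
  have di : (d i)%:Z != 0 by rewrite -lt0n.
  by rewrite /r prednK // -ltz_nat abszE ger0_norm ?modz_ge0 ?ltz_pmod ?ltz_nat.
pose phi U : {ffun 'I_m -> 'I_s.+1} * {dffun forall i : 'I_m, 'I_(d i).-1.+1} :=
  ([ffun i => Ordinal (p_le U i)], [ffun i => Ordinal (r_lt U i)]).
(* Pigeonhole: 2^s subsets against (s + 1)^m quotient vectors times prod d i = D residue vectors. *)
have : ~ {in powerset S &, injective phi}.
  move=> /leq_card_in; apply/negP; rewrite -ltnNge card_powerset.
  rewrite card_prod card_ffun !card_ord card_dep_ffun foldrE big_map.
  rewrite mulnC (leq_ltn_trans _ lt_card) // leq_mul2r; apply/orP; right.
  rewrite /D -absB -prod_d -big_enum /= enumT; apply/eq_leq.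
  by apply: eq_bigr => i _; rewrite card_ord prednK.
move=> /(@dinjectiveP _ _ phi)/dinjectivePn[U US [U' /andP[U'U U'S]]] eq_phi.
move: US U'S; rewrite !inE => US U'S.
have eq_p i : (`|p U i| %/ D = `|p U' i| %/ D)%N.
  have /= := congr1 fst eq_phi; move=> /ffunP/(_ i); rewrite !ffunE.
  by move=> /(congr1 val).
have eq_r i : r U i = r U' i.
  have /= := congr1 snd eq_phi; move=> /ffunP/(_ i); rewrite !ffunE.
  by move=> /(congr1 val).
exists (ind U - ind U'); split.
(* Equal residues put the image of the difference in B Z^m, say as B w. Equal quotients make every
   entry of adj(B) B w = det(B) w smaller than D = |det B| in absolute value, so the integer vector
   [w] vanishes. *)
- have [|w eq_w] := dP (A *m (ind U - ind U')).
    move=> i; rewrite !mulmxBr [X in (_ %| X)%Z]mxE [X in (_ %| _ + X)%Z]mxE.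
    have di : (d i)%:Z != 0 by rewrite -lt0n.
    rewrite -eqz_mod_dvd; have := congr1 Posz (eq_r i).
    by rewrite /r !abszE !ger0_norm ?modz_ge0 // => ->.
  suff w0 : w = 0 by rewrite eq_w w0 mulmx0.
  apply/matrixP => i l; rewrite {l}ord1 mxE.
  have : `|p U i - p U' i| < D%:Z by apply: divn_eq_dist.
  have -> : p U i - p U' i = (a *m (ind U - ind U')) i 0.
    rewrite -sumrB !mxE [RHS](bigID (mem S)) /= [X in _ + X]big1 ?addr0.
      by apply: eq_bigr => j _; rewrite /t !mxE; ring.
    move=> j jS; rewrite !mxE (contraNF (fintype.subsetP US j)) //.
    by rewrite (contraNF (fintype.subsetP U'S j)) // subrr mulr0.
  rewrite /a -mulmxA eq_w mulmxA mul_adj_mx mul_scalar_mx mxE normrM.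
  rewrite -abszE absB -[X in _ < X]mulr1 ltr_pM2l ?ltz_nat //.
  by move: (w i 0) => w0; lia.
- apply: contra U'U => /eqP eq_ind; apply/eqP/setP => j.
  have := congr1 (fun v : 'cV_n => v j 0) eq_ind; rewrite !mxE => /eqP.
  by case: (j \in U); case: (j \in U').
- by move=> j; rewrite !mxE; case: (j \in U); case: (j \in U').
- move=> j jS; rewrite !mxE (contraNF (fintype.subsetP US j)) //.
  by rewrite (contraNF (fintype.subsetP U'S j)) // subrr.
Qed.

End Sparsity.

Section SparseOptimal.
Variables (m n : nat) (A : 'M[int]_(m, n)) (b : 'cV[int]_m) (c : 'cV[int]_n).

(** The gap to an upper bound of the objective is a natural number that every improvement lowers. *)
Lemma exists_ip_optimal :
  (exists z, ip_feasible A b z) -> ip_bounded A b c -> exists z, ip_optimal A b c z.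
Proof.
move=> [z z_feas] [M objM].
have [N] := ubnP `|(M - ip_obj c z)%R|%N; elim: N z z_feas => // N IH z z_feas leN.
case: (classic (forall z', ip_feasible A b z' -> ip_obj c z' <= ip_obj c z)).
  by exists z.
move=> /not_all_ex_not[z' better]; have [z'_feas /negP] := imply_to_and _ _ better.
rewrite -ltNge => lt_obj.
by apply: (IH z') => //; have := objM _ z_feas; have := objM _ z'_feas; lia.
Qed.

Let card_supp (z : 'cV[int]_n) := #|[set j | z j 0 != 0]|.

Lemma ip_obj_addZ (z y : 'cV[int]_n) (t : int) :
  ip_obj c (z + t *: y) = ip_obj c z + t * ip_obj c y.
Proof.
rewrite /ip_obj mulr_sumr -big_split; apply: eq_bigr => j _ /=.
by rewrite !mxE mulrDr mulrCA.
Qed.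

(** As z >= 1 wherever [y] is nonzero, z + y and z - y are both feasible, so [y] leaves the
    objective unchanged. Moving along [y] by the smallest z k with y k = -1 then kills that
    coordinate and creates no new one. *)
Lemma ip_optimal_shrink (z y : 'cV[int]_n) j : ip_optimal A b c z -> A *m y = 0 ->
  (forall k, `|y k 0| <= 1) -> (forall k, z k 0 = 0 -> y k 0 = 0) -> y j 0 < 0 ->
  exists2 z', ip_optimal A b c z' & (card_supp z' < card_supp z)%N.
Proof.
move=> [[Az z_ge0] z_max] Ay0 y_le1 zy yj.
have z_gt k : y k 0 != 0 -> 1 <= z k 0.
  move=> yk; rewrite -gtz0_ge1 lt_neqAle z_ge0 eq_sym andbT.
  by apply: contra yk => /eqP/zy->.
case: (@Order.TotalTheory.arg_minP _ _ _ j (fun k => y k 0 < 0) (fun k => z k 0) yj)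
  => k yk kmin.
have feas t : (forall l, 0 <= z l 0 + t * y l 0) -> ip_feasible A b (z + t *: y).
  by move=> h; split=> [|l]; [rewrite mulmxDr Az -scalemxAr Ay0 scaler0 addr0|rewrite !mxE].
have cy0 : ip_obj c y = 0.
  have bnd l : 0 <= z l 0 + 1 * y l 0 /\ 0 <= z l 0 + -1 * y l 0.
    have := y_le1 l; have := z_ge0 l; have [-> ? _|/z_gt] := eqVneq (y l 0) 0; first lia.
    by lia.
  have := z_max _ (feas 1 (fun l => proj1 (bnd l))).
  have := z_max _ (feas (-1) (fun l => proj2 (bnd l))).
  by rewrite !ip_obj_addZ; lia.
exists (z + z k 0 *: y).
  split; last by move=> u /z_max; rewrite ip_obj_addZ cy0 mulr0 addr0.
  apply: feas => l; have := y_le1 l; have := z_ge0 l; have := z_ge0 k.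
  have [yl|yl] := lerP 0 (y l 0); first by move=> *; rewrite addr_ge0 ?mulr_ge0.
  move: (kmin _ yl) => h1 h2 h3 h4; have -> : y l 0 = -1 by lia.
  by rewrite mulrN1 subr_ge0.
apply/proper_card/properP; split.
  apply/fintype.subsetP => l; rewrite !inE; apply: contra => /eqP zl.
  by rewrite !mxE zl zy // mulr0 addr0.
exists k; rewrite !inE ?negbK ?mxE; first by have := z_gt k; rewrite lt_eqF //; lia.
have -> : y k 0 = -1 by have := y_le1 k; lia.
by rewrite mulrN1 subrr.
Qed.

Lemma exists_sparse_ip_optimal z : int_rank A = m -> ip_optimal A b c z ->
  exists2 z', ip_optimal A b c z' &
    (2 ^ card_supp z' <= DeltaM A * (card_supp z').+1 ^ m)%N.
Proof.
move=> rkA; have [N] := ubnP (card_supp z); elim: N z => // N IH z leN z_opt.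
have [le_pow|lt_pow] := leqP (2 ^ card_supp z) (DeltaM A * (card_supp z).+1 ^ m).
  by exists z.
have [y [Ay0 ynz y_le1 yS]] := exists_small_kernel_vector rkA lt_pow.
have zy k : z k 0 = 0 -> y k 0 = 0 by move=> zk; apply: yS; rewrite inE zk eqxx.
suff [z' z'_opt lt_z'] : exists2 z', ip_optimal A b c z' & (card_supp z' < card_supp z)%N.
  by apply: (IH z') => //; apply: leq_trans lt_z' _.
have [j yj] : exists j, y j 0 != 0.
  apply/existsP; apply: contraNT ynz; rewrite negb_exists => /forallP y0.
  by apply/eqP/matrixP => i l; rewrite {l}ord1 mxE; apply/eqP; rewrite -[_ == _]negbK.
have [y0|y0] := ltP (y j 0) 0; first exact: (ip_optimal_shrink z_opt Ay0 y_le1 zy y0).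
apply: (@ip_optimal_shrink z (- y) j) => //.
- by rewrite mulmxN Ay0 oppr0.
- by move=> k; rewrite mxE normrN.
- by move=> k /zy yk; rewrite mxE yk oppr0.
- by rewrite mxE oppr_lt0 lt_neqAle eq_sym yj.
Qed.
End SparseOptimal.

(** * Linear relaxation *)

(** The factors 1 and -1 are kept to match the two instances of [feas] in [vertex_ker_on]. *)
Lemma midpoint (F : realFieldType) (a d : F) :
  a = 2^-1 * (a + 1 * d) + (1 - 2^-1) * (a + -1 * d).
Proof. by field. Qed.

Section Real.
Variables (m n : nat) (A : 'M[int]_(m, n)) (b : 'cV[int]_m) (c : 'cV[int]_n).
Implicit Types (x u : 'I_n -> R).

Lemma int_to_RE (z : int) : int_to_R z = z%:~R.
Proof. by case: z => k; rewrite /int_to_R INRE // NegzE rmorphN. Qed.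

Lemma lp_feasibleP u : lp_feasible A b u <->
  map_mx intr A *m (\col_j u j) = map_mx intr b /\ forall j, 0 <= u j.
Proof.
split=> -[Au u0]; split; try by move=> j; apply/RleP.
- apply/matrixP => i k; rewrite {k}ord1 !mxE -int_to_RE -Au; apply: eq_bigr => j _.
  by rewrite !mxE int_to_RE.
- move=> i; have := congr1 (fun v : 'cV_m => v i 0) Au; rewrite !mxE int_to_RE => <-.
  by apply: eq_bigr => j _; rewrite !mxE int_to_RE.
Qed.

Lemma lp_objE u : lp_obj c u = \sum_j (c j 0)%:~R * u j.
Proof. by apply: eq_bigr => j _; rewrite int_to_RE. Qed.

(** A nonzero kernel vector [w] on the support of [x], scaled by the ratio test, would make [x] the
    midpoint of the feasible points x + t w and x - t w, which differ at [j] because t w j = x j is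
    nonzero. *)
Lemma vertex_ker_on x : lp_vertex A b x -> ker_on R A (supp (\col_j x j)) = 0.
Proof.
move=> [/lp_feasibleP[Ax x_ge0] x_extr]; apply/eqP/rowV0P => v.
rewrite -[v]trmxK; move: v^T => w /ker_onP[Aw0 wS]; apply/eqP; rewrite trmx_eq0.
apply/contraT => wnz.
have wx k : x k = 0 -> w k 0 = 0 by move=> xk; apply: wS; rewrite inE negbK mxE xk.
have [|j wj ratio] := @ratio_test _ _ (\col_j x j) w wnz.
  by move=> k; rewrite mxE => /wx.
set t := _ / w j 0 in ratio.
have xj : x j != 0 by apply: contraNneq wj => /wx ->.
have feas (e : R) : `|e| = 1 -> lp_feasible A b (fun k => x k + e * (t * w k 0)).
  move=> e1; apply/lp_feasibleP; split.
    have -> : \col_k (x k + e * (t * w k 0)) = \col_k x k + (e * t) *: w.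
      by apply/matrixP => k l; rewrite {l}ord1 !mxE mulrA.
    by rewrite mulmxDr Ax -scalemxAr Aw0 scaler0 addr0.
  move=> k; have := ratio k; rewrite -normrM mxE (ger0_norm (x_ge0 k)) => le_x.
  have : `|e * (t * w k 0)| <= x k by rewrite normrM e1 mul1r.
  by rewrite ler_norml => /andP[h _]; lra.
have := x_extr _ _ (feas 1 (normr1 _)) (feas (-1) (normrN1 _)) (2^-1 : R).
have /RltP half_gt0 : (0 : R) < 2^-1 by rewrite invr_gt0 ltr0n.
have /RltP half_lt1 : (2^-1 : R) < 1 by rewrite invf_lt1 ?ltr0n ?ltr1n.
move=> /(_ half_gt0 half_lt1) eq_seg.
have : x j + 1 * (t * w j 0) = x j + -1 * (t * w j 0).
  by apply: eq_seg => k; exact: midpoint.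
have -> : t * w j 0 = x j by rewrite /t mxE divfK.
by rewrite mul1r mulN1r subrr => /eqP; rewrite -mulr2n mulrn_eq0 (negPf xj).
Qed.

Lemma prox_bound_ge s : (0 < m)%N -> int_rank A = m ->
  (2 ^ s <= DeltaM A * s.+1 ^ m)%N ->
  s%:R * (m.+1 * DeltaM A)%:R <= prox_bound m (DeltaM A).
Proof.
move=> m0 rkA le_pow; have [f detf absf] := DeltaM_attained rkA.
have D0 : (0 < DeltaM A)%N by rewrite -absf absz_gt0.
have /RleP := sparsity_bound m0 D0 le_pow.
rewrite /prox_bound; set P := Rmult _ (log2 _) => leP.
rewrite natrM mulrA mulrC -addn1 natrD mulrC INRE.
rewrite [leRHS]RmultE ler_wpM2r // mulrC.
by move: leP; rewrite !RmultE RplusE !INRE.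
Qed.
End Real.

Theorem theorem1 (m n : nat) (A : 'M[int]_(m, n)) (b : 'cV[int]_m) (c : 'cV[int]_n) :
  (1 <= m)%N ->
  int_rank A = m ->
  (exists z, ip_feasible A b z) ->
  ip_bounded A b c ->
  forall x : 'I_n -> R, lp_optimal_vertex A b c x ->
  exists zs : 'cV[int]_n, ip_optimal A b c zs /\
    Rlt (l1_dist zs x) (prox_bound m (DeltaM A)).
Proof.
move=> m0 rkA feas bnd x [x_vert x_max]; pose xv : 'cV[R]_n := \col_j x j.
have xvE j : xv j 0 = x j by rewrite mxE.
have [/lp_feasibleP[Ax x_ge0] _] := x_vert.
have [z0 z0_opt] := exists_ip_optimal feas bnd.
have [z z_opt le_pow] := exists_sparse_ip_optimal rkA z0_opt.
set s := #|_| in le_pow.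
(* The kernel space on the support of [x] is zero, so the one on the union of both supports has
   dimension at most [s]. *)
have rk := rank_ker_on_setU [set j | z j 0 != 0] (vertex_ker_on x_vert).
have xv_ge0 j : 0 <= xv j 0 by rewrite xvE.
have xv_max (u : 'cV[R]_n) : map_mx intr A *m u = map_mx intr b ->
    (forall j, 0 <= u j 0) ->
    \sum_j (c j 0)%:~R * u j 0 <= \sum_j (c j 0)%:~R * xv j 0.
  move=> Au u0; have uE : u = \col_j u j 0.
    by apply/matrixP => i k; rewrite {k}ord1 mxE.
  have /x_max/RleP : lp_feasible A b (fun j => u j 0).
    by apply/lp_feasibleP; split; rewrite // -uE.
  by rewrite !lp_objE; under [X in _ -> _ <= X]eq_bigr => j _ do rewrite xvE.
have outside j : j \notin supp xv :|: [set j | z j 0 != 0] -> xv j 0 = 0 /\ z j 0 = 0.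
  by rewrite !inE negb_or !negbK => /andP[/eqP-> /eqP->].
have [N bound_N] : exists N : nat, \sum_j `|(z j 0)%:~R - xv j 0| <= N%:R.
  by eexists; apply/ltW/archi_boundP/sumr_ge0.
have [z' z'_opt z'_near] :=
  ip_optimal_proximity rkA Ax xv_ge0 xv_max z_opt outside rk bound_N.
exists z'; split=> //; apply/RltP.
have -> : l1_dist z' x = \sum_j `|(z' j 0)%:~R - xv j 0|.
  by apply: eq_bigr => j _; rewrite xvE RabsE int_to_RE.
have D0 : (0 < DeltaM A)%N.
  by have [f detf <-] := DeltaM_attained rkA; rewrite absz_gt0.
case: z'_near => [z'x|lt_z']; last exact: lt_le_trans lt_z' (prox_bound_ge m0 rkA le_pow).
rewrite big1 => [|j _]; last by rewrite z'x subrr normr0.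
(* With [s = 1] the same estimate shows that the bound is positive. *)
apply: lt_le_trans (prox_bound_ge (s := 1) m0 rkA _); first by rewrite mul1r ltr0n muln_gt0.
by rewrite -[leqLHS]mul1n leq_mul // leq_exp2l.
Qed.
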